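(* Let $G$ be a group whose power graph $P(G)$ satisfies $\alpha(P(G))<\infty$. Then either $G$ is finite, or $G\cong C_{p^{\infty}}\times H$ for some prime $p$ and some finite group $H$ with $p\nmid |H|$.
   Context: The power graph $P(G)$ of a group $G$ is the undirected graph with vertex set $G$ in which two distinct elements are adjacent if and only if one of them is a positive power of the other. An independent set in a graph is a set of pairwise non-adjacent vertices; the independence number $\alpha(\Gamma)$ of a graph $\Gamma$ is the cardinality of a largest independent set. $C_{p^\infty}$ denotes the $p$-quasicyclic (Prüfer) group, i.e. the $p$-primary component of $\mathbb{Q}/\mathbb{Z}$. *)

(* Defs.v *)
From HB Require Import structures.
From mathcomp Require Import all_boot all_order all_fingroup all_algebra.
From mathcomp Require Import ring_quotient.
From mathcomp Require Import boolp classical_sets cardinality.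

Set Implicit Arguments.
Unset Strict Implicit.
Unset Printing Implicit Defensive.

Local Open Scope classical_set_scope.
Local Open Scope card_scope.
Local Open Scope group_scope.

(* Graphs on a possibly infinite vertex type T are given by their adjacency
   relation e : T -> T -> Prop. *)
Definition independent (T : Type) (e : T -> T -> Prop) (A : set T) : Prop :=
  forall x y, A x -> A y -> x <> y -> ~ e x y.

Definition is_independence_number (T : Type) (e : T -> T -> Prop) (n : nat) :
    Prop :=
  (exists2 A : set T, independent e A & A #= `I_n) /\
  (forall A : set T, independent e A -> A #<= `I_n).

Definition finite_independence_number (T : Type) (e : T -> T -> Prop) : Prop :=
  exists n : nat, is_independence_number e n.

(* Positive powers only: in an infinite group this is not the same as one
   element lying in the cyclic subgroup generated by the other. *)
Definition power_graph (G : groupType) (x y : G) : Prop :=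
  x <> y /\ exists2 n : nat, (0 < n)%N & (y = x ^+ n \/ x = y ^+ n).

Definition isomorphic (G K : groupType) : Prop :=
  exists f : {multiplicative G -> K}, bijective f.

Definition integers : {pred rat} := fun x => x \is a Num.int.

Lemma integers_zmod_closed : zmod_closed integers.
Proof. by split=> [|x y]; [exact: GRing.rpred0 | exact: GRing.rpredB]. Qed.

HB.instance Definition _ :=
  GRing.isZmodClosed.Build rat integers integers_zmod_closed.

(* Q/Z, written multiplicatively. *)
Definition QmodZ : groupType :=
  Algebra.to_multiplicative (Quotient.quot integers).

Definition primary (G : groupType) (p : nat) : {pred G} :=
  fun x => `[< exists n : nat, x ^+ (p ^ n)%N = 1 >].

Lemma primary_group_closed (p : nat) : group_closed (@primary QmodZ p).
Proof.
have QC (x y : QmodZ) : commute x y by exact: GRing.addrC.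
split=> [|x y /asboolP[m xm] /asboolP[n yn]].
  by apply/asboolP; exists 0%N; rewrite expg1n.
apply/asboolP; exists (m + n)%N; rewrite expgMn; last exact: QC.
by rewrite expnD expgM xm expg1n mul1g mulnC expgM expVgn yn invg1 expg1n.
Qed.

(* C_{p^oo} as the p-primary component of Q/Z. *)
Definition quasicyclic (p : nat) : Type := {x : QmodZ | primary p x}.

HB.instance Definition _ (p : nat) := SubChoice.on (quasicyclic p).
HB.instance Definition _ (p : nat) :=
  SubChoice_isSubGroup.Build QmodZ (@primary QmodZ p) (quasicyclic p)
    (primary_group_closed p).

(* Main.v *)
From HB Require Import structures.
Require Import Defs.
From mathcomp Require Import all_boot all_order all_fingroup all_algebra.
From mathcomp Require Import boolp classical_sets cardinality.
From mathcomp Require Import pgroup cyclic finmap.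

(** Call a family of elements independent when no member is a positive power
of another member; such a family has at most alpha(P(G)) members, and every
finiteness statement below comes from exhibiting one.

The powers of an element of infinite order with exponents in [N, 2N) are
independent, so G is torsion. Elements of a given order m are powers of one
another exactly when they generate the same subgroup, so G has at most
alpha(P(G)) cyclic subgroups of order m and only finitely many elements of
each order. If G is infinite, its element orders are unbounded; as elements
of distinct prime orders are independent, only finitely many primes are
involved, and some prime p has elements of order p^k for all k
[pprimary_unbounded]. Koenig's lemma, applied to the finitely branching tree
of p-th roots, then yields a Pruefer subgroup P, generated by x_1, x_2, ...
with x_(k+1)^p = x_k [prufer_sequence_exists].

- P is central: an element g has finitely many conjugates, so its centralizer
  meets P in a subgroup of finite index, and P has no proper one
  [prufer_seq_central].
- P contains every p-element: P is divisible, so a p-element outside P can be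
  corrected to some w of order p outside P, and then the x_k w are
  independent [prufer_span_pprimary].
- There are finitely many elements of order prime to p: if h_1, h_2, ... have
  orders d_1 > d_2 > ..., pairing them with x_k of increasing order makes the
  products independent, since divisibility of the orders would have to go in
  opposite directions in the two factors [pfree_finite].

Every element is the product of a p-element and of one of order prime to p, so
the quotient H = G / P is finite, and by Cauchy its order m is prime to p. The
transfer homomorphism v : G -> P is a |-> a^m on the central subgroup P
[transfer], hence bijective there, and g |-> (v g, g P) is an isomorphism from
G onto P * H. Working with the quotient and the transfer avoids having to
show beforehand that the elements of order prime to p form a subgroup. *)

Set Implicit Arguments.
Unset Strict Implicit.
Unset Printing Implicit Defensive.

Local Open Scope card_scope.
Local Open Scope group_scope.
Local Open Scope classical_set_scope.

(** * Orders of elements *)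

(** The index of divisibility makes sense of the order of any element of a
possibly infinite group: it is 0 exactly when the order is infinite. *)
Definition elt_order (G : groupType) (x : G) : nat :=
  xget 0%N [set m | forall k, x ^+ k = 1 <-> (m %| k)%N].

Section EltOrder.
Variable G : groupType.
Implicit Types x y : G.

Lemma elt_order_dvd x k : x ^+ k = 1 <-> (elt_order x %| k)%N.
Proof.
suff: exists m, forall k, x ^+ k = 1 <-> (m %| k)%N.
  by move=> /(xgetPex 0%N) /(_ k).
have [xtor|xfree] := pselect (exists k, (0 < k)%N && (x ^+ k == 1)); last first.
  exists 0%N => -[|j]; first by rewrite dvdn0.
  rewrite dvd0n; split=> // xj; case: xfree; exists j.+1.
  exact/eqP.
case: (ex_minnP xtor) => m /andP[m_gt0 /eqP xm] m_min.
exists m => j; split=> [xj|/dvdnP[q ->]]; last first.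
  by rewrite mulnC expgnA xm expg1n.
rewrite /dvdn; apply: contraT; rewrite -lt0n => r_gt0.
have: (m <= j %% m)%N.
  apply: m_min; rewrite r_gt0 /=; apply/eqP.
  by rewrite -xj {2}(divn_eq j m) expgnDr mulnC expgnA xm expg1n mul1g.
by rewrite leqNgt ltn_pmod.
Qed.

Lemma expg_elt_order x : x ^+ elt_order x = 1.
Proof. exact/elt_order_dvd. Qed.

Lemma elt_order_gt0 x m : (0 < m)%N -> x ^+ m = 1 -> (0 < elt_order x)%N.
Proof. by move=> m_gt0 /elt_order_dvd; apply: dvdn_gt0. Qed.

Lemma elt_orderX x d : (0 < elt_order x)%N -> (d %| elt_order x)%N ->
  elt_order (x ^+ (elt_order x %/ d)) = d.
Proof.
move=> ox_gt0 dvd_d; set m := elt_order x in ox_gt0 dvd_d *.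
have d_gt0 := dvdn_gt0 ox_gt0 dvd_d.
have q_gt0 : (0 < m %/ d)%N by rewrite divn_gt0 // dvdn_leq.
have oE k : (elt_order (x ^+ (m %/ d)) %| k)%N = (d %| k)%N.
  by apply/idP/idP => [/elt_order_dvd|dk];
    [rewrite -expgnA => /elt_order_dvd | apply/elt_order_dvd;
     rewrite -expgnA; apply/elt_order_dvd];
    rewrite -/m -{1}(divnK dvd_d) dvdn_pmul2l.
by apply/eqP; rewrite eqn_dvd oE dvdnn -oE dvdnn.
Qed.

(** By Bezout, k is invertible modulo m, so the k-th power map is a bijection
of the subgroup generated by x. *)
Lemma expg_coprimeK x k m : x ^+ m = 1 -> coprime k m ->
  exists j, x = (x ^+ k) ^+ j.
Proof.
move=> xm co_km; have /eqP u1 := chinese_modl co_km 0 1.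
have /eqP u2 := chinese_modr co_km 0 1; set u := chinese k m 0 1 in u1 u2.
exists (u %/ k)%N; rewrite -expgnA mulnC divnK; last first.
  by rewrite /dvdn (eqP u1) mod0n.
rewrite (divn_eq u m) (eqP u2) mulnC expgnDr expgnA xm expg1n mul1g.
case: m xm {u u1 u2 co_km} => [_|[|m] xm]; rewrite ?modn0 ?modn1 ?expg1 //.
Qed.

(** A cyclic subgroup contained in a finite one of the same order is equal to
it. Concretely, d = gcd k m makes the order m of y ^+ k divide m / d, which
forces d = 1. *)
Lemma cyclic_subgroup_sym x y k : (0 < elt_order x)%N ->
  elt_order x = elt_order y -> x = y ^+ k -> exists j, y = x ^+ j.
Proof.
move=> ox_gt0 oxy xE; rewrite xE; apply: (@expg_coprimeK _ _ (elt_order y)).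
  exact: expg_elt_order.
set m := elt_order y; have m_gt0 : (0 < m)%N by rewrite /m -oxy.
set d := gcdn k m; have d_gt0 : (0 < d)%N by rewrite gcdn_gt0 m_gt0 orbT.
have: (m %| m %/ d)%N.
  rewrite {1}/m -oxy; apply/elt_order_dvd; rewrite xE -expgnA.
  have -> : (k * (m %/ d) = m * (k %/ d))%N.
    by rewrite muln_divA ?dvdn_gcdr // mulnC -muln_divA // dvdn_gcdl.
  by rewrite expgnA expg_elt_order expg1n.
move/dvdn_leq; rewrite divn_gt0 // dvdn_leq ?dvdn_gcdr // => /(_ isT).
rewrite leqNgt => mdm; rewrite /coprime -/d eqn_leq d_gt0 andbT.
by apply: contraR mdm; rewrite -ltnNge => d_gt1; apply: ltn_Pdiv.
Qed.

End EltOrder.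

(** * Consequences of a finite independence number *)

Lemma finite_nat_bounded (A : set nat) : finite_set A ->
  exists B, forall a, A a -> (a < B)%N.
Proof.
move=> /finite_fsetP[X ->]; exists (\max_(i <- X) i).+1 => a /= aX.
by rewrite ltnS; apply: leq_bigmax_seq.
Qed.

(** Indexing the independent set and allowing i = j makes the injectivity of f
on A part of the condition (take k = 1). *)
Definition power_independent (G : groupType) (I : Type) (A : set I)
    (f : I -> G) : Prop :=
  forall i j k, A i -> A j -> (0 < k)%N -> f i = f j ^+ k -> i = j.

Section FiniteIndependence.
Variables (G : groupType) (n : nat).
Hypothesis alphaG : is_independence_number (@power_graph G) n.
Implicit Types x y : G.

Lemma power_independent_card_le (I : Type) (A : set I) (f : I -> G) :
  power_independent A f -> A #<= `I_n.
Proof.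
move=> indA; have finj : {in A &, injective f}.
  by move=> i j /set_mem Ai /set_mem Aj fij; apply: (indA i j 1%N).
rewrite -(card_le_eql (inj_card_eq finj)).
apply: alphaG.2 => _ _ [i Ai <-] [j Aj <-] fij [_ [k k_gt0 [fE|fE]]].
  by apply: fij; congr f; apply/esym; apply: (indA j i k).
by apply: fij; congr f; apply: (indA i j k).
Qed.

Lemma power_independent_finite (I : Type) (A : set I) (f : I -> G) :
  power_independent A f -> finite_set A.
Proof.
by move=> /power_independent_card_le ?; apply/finite_set_leP; exists n.
Qed.

(** For x of infinite order, x ^+ a = x ^+ (b * k) means a = b * k, which is
impossible for distinct a and b in [n + 1, 2 n + 2): the n + 1 corresponding
powers of x are independent. *)
Lemma elt_torsion x : (0 < elt_order x)%N.
Proof.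
rewrite lt0n; apply/eqP => ox0.
have inj a b : (a <= b)%N -> x ^+ a = x ^+ b -> a = b.
  move=> le_ab xab; apply/eqP; rewrite eqn_leq le_ab /= -subn_eq0 -dvd0n -ox0.
  by apply/elt_order_dvd; rewrite expgnFr // xab mulgV.
suff: `I_n.+1 #<= `I_n by rewrite card_le_II ltnn.
apply: (@power_independent_card_le _ _ (fun i => x ^+ (n.+1 + i))%N).
move=> i j k /= lti ltj k_gt0; rewrite -expgnA => xij.
have eij : (n.+1 + i = (n.+1 + j) * k)%N.
  by case/orP: (leq_total (n.+1 + i) ((n.+1 + j) * k)) => le;
    [|symmetry]; apply: inj.
case: k k_gt0 eij {xij} => [//|[|k]] _; first by rewrite muln1 => /addnI.
move=> eij; have: (n.+1 * 2 <= n.+1 + i)%N.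
  by rewrite eij leq_mul // leq_addr.
by rewrite muln2 -addnn leq_add2l leqNgt lti.
Qed.

End FiniteIndependence.

(** For p prime, these properties give x k the order p ^ k, and the x k
generate a copy of the quasicyclic group. *)
Definition prufer_sequence (G : groupType) p (x : nat -> G) :=
  [/\ x 0%N = 1, x 1%N <> 1 & forall k, x k.+1 ^+ p = x k].

Section BoundedOrders.
Variables (G : groupType) (n : nat).
Hypothesis alphaG : is_independence_number (@power_graph G) n.
Implicit Types x y : G.

(** Two elements of the same finite order are adjacent only if they generate
the same subgroup, so one chosen generator for each cyclic subgroup of order m
gives an independent set, hence a finite one; each such subgroup is finite. *)
Lemma elt_order_fiber_finite m : finite_set [set x : G | elt_order x = m].
Proof.
(* [gen x] is the set of generators of the subgroup generated by x. *)
pose gen x := [set y | elt_order y = elt_order x /\ exists k, x = y ^+ k].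
pose rep x := xget 1 (gen x).
have genx x : gen x x by split=> //; exists 1%N.
have genC x y : gen x y -> gen y x.
  move=> [oyx [k xE]]; split=> //; apply: cyclic_subgroup_sym xE => //.
  exact: (elt_torsion alphaG).
have gen_trans x y z : gen x y -> gen y z -> gen x z.
  move=> [oyx [k xE]] [ozy [l yE]]; split; first by rewrite ozy.
  by exists (l * k)%N; rewrite xE yE expgnA.
have eq_rep x y : gen x y -> rep x = rep y.
  move=> xy; congr xget; apply/seteqP; split=> z; apply: gen_trans => //.
  exact: genC.
have repP x : gen x (rep x) by apply: xgetPex; exists x.
pose A := [set x | elt_order x = m /\ rep x = x].
have finA : finite_set A.
  apply: (power_independent_finite alphaG (f := id)) => x y k /=.
  move=> [ox rx] [oy ry] _ xE; rewrite -rx -ry; apply: eq_rep.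
  by split; [rewrite ox oy | exists k].
apply: (@sub_finite_set _ _ (\bigcup_(y in A) [set y ^+ k | k in `I_m])).
  move=> x /= ox; have [or [k xE]] := repP x.
  exists (rep x); first by split; [rewrite or | apply/esym/eq_rep].
  exists (k %% m)%N.
    by rewrite /= ltn_pmod // -ox (elt_torsion alphaG).
  rewrite [RHS]xE {2}(divn_eq k m) mulnC expgnDr expgnA -{2}ox -or.
  by rewrite expg_elt_order expg1n mul1g.
by apply: bigcup_finite => // y _; apply/finite_image/finite_II.
Qed.

Lemma elt_order_set_finite (A : set nat) :
  finite_set A -> finite_set [set x : G | A (elt_order x)].
Proof.
move=> finA; apply: (@sub_finite_set _ _
    (\bigcup_(m in A) [set x : G | elt_order x = m])).
  by move=> x Ax; exists (elt_order x).
by apply: bigcup_finite => // m _; apply: elt_order_fiber_finite.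
Qed.

Lemma exponent_finite m : (0 < m)%N -> finite_set [set x : G | x ^+ m = 1].
Proof.
move=> m_gt0; apply: sub_finite_set (elt_order_set_finite (finite_II m.+1)).
by move=> x /= /elt_order_dvd /(dvdn_leq m_gt0).
Qed.

(** Otherwise each prime p has some p ^ e p that is not the order of an element,
while only finitely many primes are orders of elements, as elements of distinct
prime orders are independent. Then all orders divide one product M of the
p ^ e p, and G consists of the finitely many elements of exponent M. *)
Lemma pprimary_unbounded : infinite_set [set: G] ->
  exists2 p, prime p & forall k, exists x : G, elt_order x = (p ^ k)%N.
Proof.
move=> infG; apply: contrapT => noP.
have bound p : exists e, prime p -> forall x : G, elt_order x <> (p ^ e)%N.
  have [pr_p|] := boolP (prime p); last by exists 0%N.
  apply: contrapT => noe; apply: noP; exists p => // k; apply: contrapT => nox.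
  by apply: noe; exists k => _ x ox; apply: nox; exists x.
have {noP bound} [e eP] := choice bound.
have ord_div (x : G) d : (d %| elt_order x)%N -> exists y : G, elt_order y = d.
  by move/(elt_orderX (elt_torsion alphaG x)) => <-; eexists.
have [B ltB] : exists B, forall p, prime p -> (exists x : G, elt_order x = p) ->
    (p < B)%N.
  pose A := [set p | prime p /\ exists x : G, elt_order x = p].
  have [f fP] : {f : nat -> G & forall p, A p -> elt_order (f p) = p}.
    apply: (@choice _ _ (fun p (x : G) => A p -> elt_order x = p)) => p.
    by have [[_ [x xP]]|] := pselect (A p); [exists x | exists 1].
  suff /finite_nat_bounded [B ltB] : finite_set A.
    by exists B => p pr_p px; apply: ltB.
  apply: (power_independent_finite alphaG (f := f)) => p q k Ap Aq _ fE.
  have : (p %| q)%N.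
    rewrite -(fP p) //; apply/elt_order_dvd.
    by rewrite fE -expgnA mulnC expgnA -{2}(fP q) // expg_elt_order expg1n.
  by rewrite dvdn_prime2 ?Ap.1 ?Aq.1 // => /eqP.
pose M := (\prod_(p < B | prime p) p ^ e p)%N.
have M_gt0 : (0 < M)%N.
  by apply: prodn_cond_gt0 => p pr_p; rewrite expn_gt0 prime_gt0.
apply: infG; apply: sub_finite_set (exponent_finite M_gt0) => x _ /=.
apply/elt_order_dvd/dvdn_partP => [|p]; first exact: (elt_torsion alphaG).
rewrite mem_primes => /and3P[pr_p _ p_dvd]; rewrite p_part.
have ltpB : (p < B)%N by apply: ltB => //; apply: ord_div p_dvd.
apply: (@dvdn_trans (p ^ e p)); last first.
  by rewrite /M (bigD1 (Ordinal ltpB)) //= dvdn_mulr.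
apply: dvdn_exp2l; rewrite leqNgt; apply/negP => lt_e.
have [//|y oy] := @ord_div x (p ^ e p)%N; last exact: eP oy.
by rewrite pfactor_dvdn ?(elt_torsion alphaG) // ltnW.
Qed.

(** The compactness step of Koenig's lemma: if S meets the p ^ j-th powers for
every j, some single element of S is a p ^ j-th power for every j. Were each y
in S not a p ^ J y-th power, a bound B on the finitely many J y would give a
p ^ B-th power in S, which is a p ^ J y-th power too. *)
Lemma divisible_in_finite p (S : set G) : finite_set S ->
  (forall j, exists z, S (z ^+ (p ^ j)%N)) ->
  exists2 y, S y & forall j, exists z, z ^+ (p ^ j)%N = y.
Proof.
move=> finS divS; apply: contrapT => noy.
have [J JP] : {J : G -> nat & forall y, S y -> forall z,
    z ^+ (p ^ J y)%N <> y}.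
  apply: (@choice _ _ (fun (y : G) j =>
    S y -> forall z, z ^+ (p ^ j)%N <> y)) => y.
  apply: contrapT => noj; apply: (noj); exists 0%N => Sy; exfalso.
  apply: noy; exists y => // j; apply: contrapT => noz.
  by apply: noj; exists j => _ z zE; apply: noz; exists z.
have [B ltB] := finite_nat_bounded (finite_image J finS).
have [z Sz] := divS B; apply: (JP _ Sz (z ^+ (p ^ (B - J (z ^+ (p ^ B))))%N)).
by rewrite -expgnA -expnD subnK // ltnW //; apply: ltB; exists (z ^+ (p ^ B)%N).
Qed.

(** [D] collects the elements with p ^ j-th roots for all j. It contains an
element of order p, and each of its elements has a p-th root in [D]; both
follow from [divisible_in_finite], as p-th roots of a torsion element are
finite in number. Iterating the choice of such a root gives the sequence. *)
Lemma prufer_sequence_exists p : prime p ->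
  (forall k, exists x : G, elt_order x = (p ^ k)%N) ->
  exists x : nat -> G, prufer_sequence p x.
Proof.
move=> pr_p px; have p_gt0 := prime_gt0 pr_p.
pose D (y : G) := forall j, exists z, z ^+ (p ^ j)%N = y.
have [|j|a [aP aN1] Da] :=
    @divisible_in_finite p [set y | y ^+ p = 1 /\ y <> 1].
- by apply: sub_finite_set (exponent_finite p_gt0) => y [].
- have [z oz] := px j.+1; exists z; split=> [|/elt_order_dvd].
    by rewrite -expgnA -expnSr -oz expg_elt_order.
  by rewrite oz dvdn_Pexp2l ?prime_gt1 // ltnn.
have [f fP] : {f : G -> G & forall y, D y -> f y ^+ p = y /\ D (f y)}.
  apply: (@choice _ _ (fun y z : G => D y -> z ^+ p = y /\ D z)) => y.
  have [Dy|] := pselect (D y); last by exists y.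
  have [|j|z zE Dz] := @divisible_in_finite p [set z | z ^+ p = y].
  - have op_gt0 : (0 < p * elt_order y)%N.
      by rewrite muln_gt0 p_gt0 (elt_torsion alphaG).
    apply: sub_finite_set (exponent_finite op_gt0) => z /= zE.
    by rewrite expgnA zE expg_elt_order.
  - by have [z zE] := Dy j.+1; exists z; rewrite /= -expgnA -expnSr.
  - by exists z.
exists (fun k => if k is j.+1 then iter j f a else 1); split=> // -[//|k].
suff Dk : D (iter k f a) by rewrite iterS; case: (fP _ Dk).
by elim: k => [//|k IH]; rewrite iterS; case: (fP _ IH).
Qed.

End BoundedOrders.

(** * The Pruefer subgroup and its complement *)

Section PruferSpan.
Variables (G : groupType) (p : nat) (x : nat -> G).
Hypotheses (pr_p : prime p) (xP : prufer_sequence p x).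

Definition prufer_span : set G := [set y | exists k i, y = x k ^+ i].

Lemma prufer_seq_shift k d : x (k + d)%N ^+ (p ^ d)%N = x k.
Proof.
case: xP => _ _ xS; elim: d => [|d IH]; first by rewrite addn0 expg1.
by rewrite addnS expnS expgnA xS.
Qed.

(** Induction on k: from x (k+1) ^+ i = 1 one gets i = p ^ k * j and then
x 1 ^+ j = 1, where x 1 has order exactly p. *)
Lemma prufer_seq_eq1 k i : x k ^+ i = 1 <-> (p ^ k %| i)%N.
Proof.
have [x0 x1 xS] := xP; split=> [|/dvdnP[q ->]]; last first.
  by rewrite mulnC expgnA -[X in x X]add0n prufer_seq_shift x0 expg1n.
elim: k i => [|k IH] i xi; first by rewrite dvd1n.
have /dvdnP[j iE] : (p ^ k %| i)%N.
  by apply: IH; rewrite -xS -expgnA mulnC expgnA xi expg1n.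
have {xi}x1j : x 1%N ^+ j = 1.
  by rewrite -(prufer_seq_shift 1 k) -expgnA mulnC -iE add1n.
rewrite iE expnS dvdn_pmul2r ?expn_gt0 ?prime_gt0 //.
rewrite -[(p %| j)%N]negbK -prime_coprime //; apply/negP => co_pj.
case: x1; have x1p : x 1%N ^+ p = 1 by rewrite xS.
have [l ->] : exists l, x 1%N = (x 1%N ^+ j) ^+ l.
  by apply: expg_coprimeK x1p _; rewrite coprime_sym.
by rewrite x1j expg1n.
Qed.

Lemma prufer_seq_eqmod k a b : x k ^+ a = x k ^+ b <-> a = b %[mod p ^ k].
Proof.
wlog le_ab : a b / (a <= b)%N.
  case/orP: (leq_total a b) => le W; first exact: W.
  by split=> /esym /(W b a le).
apply: (@iff_trans _ (x k ^+ (b - a)%N = 1)).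
  by rewrite expgnFr //; split=> [->|/divg1_eq //]; rewrite mulgV.
apply: (iff_trans (prufer_seq_eq1 _ _)); rewrite -eqn_mod_dvd // eq_sym.
by split=> /eqP.
Qed.

Lemma prufer_span1 : prufer_span 1.
Proof. by exists 0%N, 0%N. Qed.

Lemma prufer_span_seq k : prufer_span (x k).
Proof. by exists k, 1%N. Qed.

Lemma prufer_spanX y n : prufer_span y -> prufer_span (y ^+ n).
Proof. by move=> [k [i ->]]; exists k, (i * n)%N; rewrite expgnA. Qed.

Lemma prufer_span_exponent y : prufer_span y -> exists j, y ^+ (p ^ j)%N = 1.
Proof.
by move=> [k [i ->]]; exists k; rewrite -expgnA; apply/prufer_seq_eq1/dvdn_mull.
Qed.

Lemma prufer_spanM y z : prufer_span y -> prufer_span z -> prufer_span (y * z).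
Proof.
move=> [k [i ->]] [l [j ->]]; exists (k + l)%N, (p ^ l * i + p ^ k * j)%N.
by rewrite expgnDr !expgnA prufer_seq_shift addnC prufer_seq_shift.
Qed.

Lemma prufer_spanV y : prufer_span y -> prufer_span y^-1.
Proof.
move=> Py; have [j yj] := prufer_span_exponent Py.
suff -> : y^-1 = y ^+ (p ^ j).-1 by apply: prufer_spanX.
apply: mulg1_eq; rewrite -expgS prednK // expn_gt0 prime_gt0 //.
Qed.

Lemma prufer_span_root y :
  prufer_span y -> exists2 z, prufer_span z & z ^+ p = y.
Proof.
move=> [k [i ->]]; exists (x k.+1 ^+ i); first by exists k.+1, i.
by case: xP => _ _ xS; rewrite -expgnA mulnC expgnA xS.
Qed.

Lemma prufer_span_coprime1 y m :
  prufer_span y -> ~~ (p %| m)%N -> y ^+ m = 1 -> y = 1.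
Proof.
move=> /prufer_span_exponent[j yj] pm ym.
have [l ->] : exists l, y = (y ^+ m) ^+ l.
  by apply: expg_coprimeK yj _; rewrite coprime_sym coprimeXl // prime_coprime.
by rewrite ym expg1n.
Qed.

Variable n : nat.
Hypothesis alphaG : is_independence_number (@power_graph G) n.

(** The conjugates of g by the x (k + l) are elements of exponent m, hence
finitely many, so g ^ x (k + a) = g ^ w with w = x (k + b) for some a < b. As
x (k + a) = w ^+ q with q = p ^ (b - a), the power w ^+ (q - 1) centralizes g;
q - 1 is prime to p, so w does too, and x k is a power of w. *)
Lemma prufer_seq_central k (g : G) : commute (x k) g.
Proof.
pose m := elt_order g; have m_gt0 : (0 < m)%N by exact: elt_torsion alphaG g.
have [a [b [lt_ab gab]]] :
    exists a b, (a < b)%N /\ g ^ x (k + a)%N = g ^ x (k + b)%N.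
  apply: contrapT => noab; apply: infinite_nat.
  have := finite_preimage (f := fun l => g ^ x (k + l)%N) _
    (exponent_finite alphaG m_gt0).
  move=> fin; apply: sub_finite_set (fin _).
    by move=> l _ /=; rewrite -conjXg expg_elt_order conj1g.
  move=> a b _ _ gab; apply: contrapT => /eqP; rewrite neq_ltn => /orP[] lt_ab.
    by apply: noab; exists a, b.
  by apply: noab; exists b, a.
set w := x (k + b)%N in gab.
pose q := (p ^ (b - a))%N.
have q_gt0 : (0 < q)%N by rewrite expn_gt0 prime_gt0.
have xaE : x (k + a)%N = w * w ^+ q.-1.
  rewrite -expgS prednK // -(prufer_seq_shift _ (b - a)) -addnA subnKC //.
  exact: ltnW.
have cwg : commute (w ^+ q.-1) g.
  apply/(can_inj (conjgK w))/esym.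
  have: (g ^ w) ^ (w ^+ q.-1) = g ^ w by rewrite -conjgM -xaE.
  move/conjg_fixP/commgP => cg.
  have ww : w ^+ q.-1 ^ w = w ^+ q.-1.
    by apply/conjg_fixP/commgP/commute_sym/commuteX.
  by rewrite !conjMg ww.
have [j wE] : exists j, w = (w ^+ q.-1) ^+ j.
  apply: (@expg_coprimeK _ _ _ (p ^ (k + b))); first exact/prufer_seq_eq1.
  rewrite coprimeXr // coprime_sym prime_coprime // -(dvdn_addr _ (dvdnn p)).
  apply/negP => pq; have: (p %| q)%N.
    by rewrite dvdn_exp // subn_gt0.
  rewrite -(prednK q_gt0) => pq'.
  by move: pq; rewrite dvdn_addr // => pq; move: pq';
     rewrite -addn1 dvdn_addr // dvdn1 => /eqP p1; move: pr_p; rewrite p1.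
rewrite -(prufer_seq_shift k b) -/w wE.
by apply/commute_sym/commuteX/commuteX/commute_sym.
Qed.

Lemma prufer_span_central y g : prufer_span y -> commute y g.
Proof.
move=> [k [i ->]]; apply/commute_sym/commuteX/commute_sym.
exact: prufer_seq_central.
Qed.

(** If w of order p is outside P, the x k * w are independent: an equality
x k * w = (x l * w) ^+ m puts w ^+ (m - 1) in P, so p divides m - 1, whence
x k = x l ^+ m with m prime to p, and comparing orders gives k = l. *)
Lemma prufer_span_exponent_p w : w ^+ p = 1 -> prufer_span w.
Proof.
move=> wp; apply: contrapT => nPw; apply: infinite_nat.
have xw k := prufer_seq_central k w.
apply: (power_independent_finite alphaG (f := fun k => x k * w)).
move=> k l m _ _ m_gt0; rewrite expgMn // => xwE.
have co_m : coprime m.-1 p = false.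
  apply/negP => co; apply: nPw.
  have [j ->] : exists j, w = (w ^+ m.-1) ^+ j by apply: expg_coprimeK wp co.
  apply: prufer_spanX.
  suff -> : w ^+ m.-1 = x k * (x l ^+ m)^-1.
    apply: prufer_spanM; first exact: prufer_span_seq.
    exact/prufer_spanV/prufer_spanX/prufer_span_seq.
  apply: (mulIg w); rewrite -expgSr prednK //.
  apply: (mulgI (x l ^+ m)); rewrite -xwE.
  rewrite !mulgA; congr (_ * w).
  have -> : commute (x l ^+ m) (x k).
    by apply/prufer_span_central/prufer_spanX/prufer_span_seq.
  by rewrite mulgK.
have p_dvd : (p %| m.-1)%N.
  by rewrite -[(_ %| _)%N]negbK -prime_coprime // coprime_sym co_m.
have wm : w ^+ m = w.
  rewrite -(prednK m_gt0) expgS; case/dvdnP: p_dvd => q ->.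
  by rewrite mulnC expgnA wp expg1n mulg1.
have xkl : x k = x l ^+ m by apply: (mulIg w); rewrite xwE wm.
have pm : ~~ (p %| m)%N.
  rewrite -(prednK m_gt0) -addn1 dvdn_addr // dvdn1.
  by apply: contraTneq pr_p => ->.
apply/eqP; rewrite eqn_leq; apply/andP; split.
  rewrite -(@dvdn_Pexp2l p) ?prime_gt1 //; apply/prufer_seq_eq1.
  by rewrite xkl -expgnA; apply/prufer_seq_eq1/dvdn_mull.
rewrite -(@dvdn_Pexp2l p) ?prime_gt1 //.
have: x l ^+ (m * p ^ k)%N = 1.
  by rewrite expgnA -xkl; apply/prufer_seq_eq1.
move/prufer_seq_eq1; rewrite Gauss_dvdr //.
by rewrite coprimeXl // prime_coprime.
Qed.

(** By induction y ^+ p is in P, so it is z ^+ p for some z in P by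
divisibility, and z^-1 * y has exponent p. *)
Lemma prufer_span_pprimary j y : y ^+ (p ^ j)%N = 1 -> prufer_span y.
Proof.
elim: j y => [|j IH] y; first by rewrite expg1 => ->; apply: prufer_span1.
rewrite expnS expgnA => /IH yp.
have [z Pz zp] := prufer_span_root yp.
have -> : y = z * (z^-1 * y) by rewrite mulVKg.
apply: (prufer_spanM Pz); apply: prufer_span_exponent_p.
have czy : commute z^-1 y by apply/prufer_span_central/prufer_spanV.
by rewrite expgMn // expVgn zp mulVg.
Qed.

(** It suffices to bound the number of orders d prime to p. With h d of order d
and M a bound for a finite set B of such orders, the elements x (M - d) * h d
are independent for d in B: the factors commute and have coprime orders, so if
the d-th is a power of the e-th then d divides e and p ^ (M - d) divides
p ^ (M - e), that is d <= e and e <= d. *)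
Lemma pfree_finite : finite_set [set h : G | ~~ (p %| elt_order h)%N].
Proof.
set Q := [set h | _].
suff finO : finite_set [set elt_order h | h in Q].
  apply: sub_finite_set (elt_order_set_finite alphaG finO) => h Qh.
  by exists h.
apply: contrapT => infO.
have [B subB leB] := infinite_set_fset n.+1 infO.
have [M ltM] := finite_nat_bounded (finite_fset B).
have [h hP] : {h : nat -> G & forall d, d \in B ->
    Q (h d) /\ elt_order (h d) = d}.
  apply: (@choice _ _ (fun d (y : G) =>
    d \in B -> Q y /\ elt_order y = d)) => d.
  have [dB|_] := boolP (d \in B); last by exists 1.
  by have [y Qy oy] := subB _ dB; exists y.
suff: [set` B] #<= `I_n.
  by move/geq_card_fset_set; rewrite set_fsetK leqNgt leB.
apply: (power_independent_card_le alphaG (f := fun d => x (M - d)%N * h d)).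
move=> d e k /= dB eB k_gt0.
have [[Qd od] [Qe oe]] := (hP d dB, hP e eB).
have hde (j : nat) (u : G) : commute (x j) u by exact: prufer_seq_central.
rewrite expgMn // => xhE.
(* The h d and h e need not commute, so the p-part and the p'-part of the
   equation are separated by means of the central element z: it is a p-element
   killed by d * e, which is prime to p. *)
set z := (x (M - d)%N)^-1 * x (M - e)%N ^+ k.
have hE : h d = z * h e ^+ k by rewrite /z -mulgA -xhE mulKg.
have Pz : prufer_span z.
  by apply: prufer_spanM; [apply/prufer_spanV|apply/prufer_spanX];
    apply: prufer_span_seq.
have z1 : z = 1.
  apply: (@prufer_span_coprime1 _ (d * e)) => //.
    by rewrite Euclid_dvdM // negb_or -{1}od -oe Qd Qe.
  have: h d ^+ (d * e)%N = 1 by rewrite expgnA -{2}od expg_elt_order expg1n.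
  rewrite hE expgMn; last exact: prufer_span_central.
  have -> : (h e ^+ k) ^+ (d * e)%N = 1.
    by rewrite expgnAC mulnC expgnA -{2}oe expg_elt_order !expg1n.
  by rewrite mulg1.
have dvd_de : (d %| e)%N.
  rewrite -od; apply/elt_order_dvd; rewrite hE z1 mul1g -expgnA mulnC expgnA.
  by rewrite -{2}oe expg_elt_order expg1n.
apply/eqP; rewrite eqn_leq; apply/andP; split.
  by apply: dvdn_leq dvd_de; rewrite -oe; apply: elt_torsion alphaG _.
have: (p ^ (M - d) %| p ^ (M - e))%N.
  apply/prufer_seq_eq1; have -> : x (M - d)%N = x (M - e)%N ^+ k.
    by apply/(mulgI (x (M - d)%N)^-1); rewrite mulVg -/z z1.
  by rewrite -expgnA; apply/prufer_seq_eq1/dvdn_mull.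
rewrite dvdn_Pexp2l ?prime_gt1 // leqNgt; apply: contraNleq => lt_de.
by apply: ltn_sub2l => //; apply: ltM.
Qed.

(** Write the order of g as m = b * a with a a power of p and b prime to p. By
the Chinese remainder theorem some u is 0 modulo a and 1 modulo b: then g ^+ u
has order dividing b, and g * g ^- u has order dividing a. *)
Lemma prufer_span_coset (g : G) :
  exists2 h, ~~ (p %| elt_order h)%N & prufer_span (g * h^-1).
Proof.
pose m := elt_order g; have m_gt0 : (0 < m)%N by exact: elt_torsion alphaG g.
pose a := (p ^ logn p m)%N; pose b := (m %/ a)%N.
have mE : (m = b * a)%N by rewrite divnK // pfactor_dvdnn.
have pb : ~~ (p %| b)%N.
  apply/negP => p_b; have: (p ^ (logn p m).+1 %| m)%N.
    by rewrite [X in (_ %| X)%N]mE expnS dvdn_mul.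
  by rewrite pfactor_dvdn // ltnn.
have co_ab : coprime a b by rewrite /a coprimeXl // prime_coprime.
pose u := chinese a b 0 1.
have a_u : (a %| u)%N by rewrite /dvdn /u (chinese_modl co_ab) mod0n.
have u1 : u = 1 %[mod b] by exact: chinese_modr.
exists (g ^+ u).
  apply: contraNN pb => p_o; apply: dvdn_trans p_o _; apply/elt_order_dvd.
  rewrite -expgnA; apply/elt_order_dvd; rewrite -/m mE mulnC.
  by rewrite dvdn_mul.
apply: (@prufer_span_pprimary (logn p m)); rewrite -/a.
rewrite expgnFl; last exact/commuteX/commute_refl.
apply: (mulIg (g ^+ u ^+ a)); rewrite mulgVK mul1g -expgnA.
have /eqP := u1; rewrite -(eqn_pmul2r (_ : 0 < a)%N); last first.
  by rewrite expn_gt0 prime_gt0.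
rewrite !muln_modl -mE mul1n => /eqP ua.
by rewrite [in RHS](divn_eq (u * a) m) ua
  {1}(divn_eq a m) !expgnDr ![(_ * m)%N]mulnC !expgnA expg_elt_order !expg1n.
Qed.

End PruferSpan.

(** * Finite quotients and transfer *)

Section GroupOn.
Variables (T : finType) (mul : T -> T -> T) (one : T) (inv : T -> T).
Hypotheses (mulA : associative mul) (mul1 : left_id one mul)
  (mulV : left_inverse one inv mul).

(** An alias of T that records the group laws in its type, so that the
group structure attached to it can be found by inference. *)
Definition group_on of associative mul & left_id one mul
  & left_inverse one inv mul : Type := T.
Local Notation H := (group_on mulA mul1 mulV).
HB.instance Definition _ := Finite.on H.
HB.instance Definition _ := Finite_isGroup.Build H mulA mul1 mulV.
End GroupOn.

Lemma group_structure_on_quotient (G : groupType) (T : finType)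
    (pi : G -> T) (s : T -> G) :
  cancel s pi ->
  (forall a b a' b', pi a = pi a' -> pi b = pi b' ->
    pi (a * b) = pi (a' * b')) ->
  exists (H : finGroupType) (f : G -> H) (r : H -> G),
    [/\ {morph f : a b / a * b}, cancel r f &
        forall a b, f a = f b <-> pi a = pi b].
Proof.
move=> sK piM; pose mul t u := pi (s t * s u).
have mulE a b : pi (a * b) = mul (pi a) (pi b) by apply: piM; rewrite sK.
have mulA : associative mul.
  by move=> t u v; rewrite -(sK t) -(sK u) -(sK v) -!mulE mulgA.
have mul1 : left_id (pi 1) mul.
  by move=> t; rewrite -(sK t) -!mulE mul1g.
have mulV : left_inverse (pi 1) (fun t => pi (s t)^-1) mul.
  by move=> t; rewrite -{2}(sK t) -!mulE mulVg.
by exists (group_on mulA mul1 mulV), pi, s; split.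
Qed.

(** The quotient of G by N, realized on a finite set of chosen representatives
of the cosets; r is the section given by the representatives. *)
Lemma finite_quotient (G : groupType) (N R : set G) :
  N 1 -> (forall a b, N a -> N b -> N (a * b)) -> (forall a, N a -> N a^-1) ->
  (forall a b, N a -> N (a ^ b)) ->
  finite_set R -> (forall g, exists2 h, R h & N (g * h^-1)) ->
  exists (H : finGroupType) (f : G -> H) (r : H -> G),
    [/\ {morph f : a b / a * b}, cancel r f & forall a, f a = 1 <-> N a].
Proof.
move=> N1 NM NV NJ finR coverR.
pose rep g := xget 1 [set h | N (g * h^-1)].
have repP g : N (g * (rep g)^-1).
  by apply: (@xgetPex _ 1 [set h | N (g * h^-1)]); exists g; rewrite /= mulgV.
have Nsym g h : N (g * h^-1) -> N (h * g^-1) by move=> /NV; rewrite invgF.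
have Ntrans g h k : N (g * h^-1) -> N (h * k^-1) -> N (g * k^-1).
  by move=> gh hk; rewrite -(divgKA h); apply: NM.
have eq_rep g h : rep g = rep h <-> N (g * h^-1).
  split=> [gh|gh].
    by apply: Ntrans (repP g) _; rewrite gh; apply/Nsym/repP.
  congr xget; apply/seteqP; split=> k /=; apply: Ntrans => //.
  exact: Nsym.
have : finite_set (range rep).
  apply: sub_finite_set (finite_image rep finR) => _ [g _ <-].
  by have [h Rh Ngh] := coverR g; exists h => //; apply/esym/eq_rep.
move=> /finite_fsetP[X XE].
have rX g : rep g \in X by have : range rep (rep g) by []; rewrite XE.
pose pi g : X := [` rX g]%fset.
have eq_pi g h : pi g = pi h <-> N (g * h^-1).
  rewrite -eq_rep; split=> [/(congr1 val)//|gh]; exact: val_inj.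
have piK : cancel (val : X -> G) pi.
  move=> t; apply: val_inj => /=.
  have : [set` X] (val t) by apply: valP.
  by rewrite -XE => -[g _ <-]; apply/eq_rep/Nsym/repP.
have [|H [f [r [fM rK fE]]]] := group_structure_on_quotient piK.
  move=> a b a' b' /eq_pi aa' /eq_pi bb'; apply/eq_pi.
  have -> : a * b * (a' * b')^-1 = (b * b'^-1) ^ a^-1 * (a * a'^-1).
    by rewrite invgM conjgE invgK !mulgA mulgVK.
  by apply: NM => //; apply: NJ.
exists H, f, r; split=> // a.
have f1 : f 1 = 1 by apply: (mulgI (f 1)); rewrite -fM !mulg1.
by rewrite -f1 fE eq_pi divg1.
Qed.

(** For a section r of f, the elements c g t = (r (f g * t))^-1 * g * r t of the
kernel satisfy the cocycle identity c (g * h) t = c g (f h * t) * c h t.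
Summing over t gives a homomorphism, as t |-> f h * t permutes H; on a central
a of the kernel every c a t equals a. The cocycle is kept in the conclusion so
that properties of phi on the kernel can be passed on to the sum. *)
Lemma transfer (G : groupType) (H : finGroupType) (f : G -> H) (r : H -> G)
    (V : zmodType) (phi : G -> V) :
  {morph f : a b / a * b} -> cancel r f ->
  (forall a b, f a = 1 -> commute a b) ->
  (forall a b, f a = 1 -> f b = 1 -> phi (a * b) = (phi a + phi b)%R) ->
  exists c : G -> H -> G, let v g := (\sum_t phi (c g t))%R in
    [/\ forall g t, f (c g t) = 1, forall g h, v (g * h) = (v g + v h)%R &
        forall a, f a = 1 -> v a = (phi a *+ #|H|)%R].
Proof.
move=> fM rK central phiM.
have f1 : f 1 = 1 by apply: (mulgI (f 1)); rewrite -fM !mulg1.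
have fV a : f a^-1 = (f a)^-1 by apply/esym/mulg1_eq; rewrite -fM mulgV.
pose c g t := (r (f g * t))^-1 * (g * r t).
have fc g t : f (c g t) = 1 by rewrite !fM fV !rK mulVg.
have cM g h t : c (g * h) t = c g (f h * t) * c h t.
  by rewrite /c fM !mulgA mulgK.
exists c; split=> // [g h|a fa].
  rewrite (eq_bigr _ (fun t _ => congr1 phi (cM g h t))).
  rewrite (eq_bigr _ (fun t _ => phiM _ _ (fc _ _) (fc _ _))).
  rewrite big_split /=; congr (_ + _)%R.
  by rewrite [RHS](reindex_inj (mulgI (f h))).
rewrite -(GRing.sumr_const (mem H)); apply: eq_bigr => t _.
by rewrite /c fa mul1g (central _ (r t) fa) mulKg.
Qed.

(** * Fractions in Q/Z *)

Notation QZ := (Quotient.quot integers).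

Definition QZfrac (p k a : nat) : QZ := (\pi_QZ (a%:R / (p ^ k)%:R : rat)%R)%qT.

Section QZfracTheory.
Variables (p : nat) (pr_p : prime p).
Import GRing.Theory Num.Theory.

Let pk_neq0 k : ((p ^ k)%:R != 0 :> rat)%R.
Proof. by rewrite pnatr_eq0 -lt0n expn_gt0 prime_gt0. Qed.

Lemma QZ_eq (u v : rat) :
  (\pi_QZ u = \pi_QZ v)%qT <-> (u - v)%R \is a Num.int.
Proof.
rewrite -[(_ - _)%R \is a _]/((u - v)%R \in integers) Quotient.idealrBE.
by split=> /eqP.
Qed.

Lemma QZfrac_eqmod k a b : QZfrac p k a = QZfrac p k b <-> a = b %[mod p ^ k].
Proof.
wlog le_ba : a b / (b <= a)%N.
  case/orP: (leq_total b a) => le W; first exact: W.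
  by split=> /esym /(W b a le).
apply: (iff_trans (QZ_eq _ _)); rewrite -mulrBl -natrB //.
apply: (@iff_trans _ (p ^ k %| a - b)%N); last first.
  by rewrite -eqn_mod_dvd //; split=> /eqP.
split=> [|/dvdnP[q ->]]; last by rewrite natrM mulfK // natr_int.
rewrite -[(_ / _)%R]/((a - b)%N%:~R / (p ^ k)%N%:~R)%R.
move=> /intrP[z zE]; have : ((a - b)%N%:Z = z * (p ^ k)%N%:Z)%R.
  apply/eqP; rewrite -(eqr_int rat) intrM -zE divfK //; exact: pk_neq0.
move=> /(congr1 absz); rewrite abszM !absz_nat => ->.
exact: dvdn_mull.
Qed.

Lemma QZfrac_shift k d a : QZfrac p (k + d) (p ^ d * a) = QZfrac p k a.
Proof.
congr (\pi_QZ _)%qT; rewrite natrM expnD mulnC natrM.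
by rewrite -mulf_div divff // mul1r.
Qed.

Lemma QZfracD k a b : (QZfrac p k (a + b) = QZfrac p k a + QZfrac p k b)%R.
Proof. by rewrite /QZfrac -raddfD /= natrD mulrDl. Qed.

Lemma QmodZ_expg (u : QmodZ) n : u ^+ n = ((u : QZ) *+ n)%R :> QZ.
Proof. by elim: n => [//|n IH]; rewrite expgS mulrS -IH. Qed.

Lemma QZfracMn k a n : (QZfrac p k a *+ n = QZfrac p k (n * a))%R.
Proof. by rewrite /QZfrac -raddfMn /= natrM -mulrA (mulr_natl _ n). Qed.

Lemma QZfrac0 k : QZfrac p k 0 = 0%R.
Proof. by rewrite /QZfrac mul0r raddf0. Qed.

(** If p ^ k kills the class of r, then r = z / p ^ k for an integer z, which
can be replaced by its remainder modulo p ^ k. *)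
Lemma primaryP (u : QZ) :
  primary (G := QmodZ) p u <-> exists k a, u = QZfrac p k a.
Proof.
split=> [/asboolP[k]|[k [a ->]]]; last first.
  apply/asboolP; exists k; rewrite QmodZ_expg QZfracMn.
  by rewrite -[RHS](QZfrac0 k); apply/QZfrac_eqmod; rewrite modnMr mod0n.
rewrite QmodZ_expg; elim/quotW: u => r.
rewrite -raddfMn -[RHS](raddf0 (\pi_QZ)%qT) => /QZ_eq.
rewrite subr0 => /intrP[z zE]; exists k, (absz (z %% (p ^ k)%N%:Z)%Z).
apply/QZ_eq.
have -> : r = (z%:~R / (p ^ k)%:R)%R.
  by rewrite -zE -(mulr_natr r) mulfK.
have m_ge0 : (0 <= z %% (p ^ k)%N%:Z)%Z%R.
  by rewrite modz_ge0 // eqz_nat -lt0n expn_gt0 prime_gt0.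
rewrite -mulrBl natr_absz ger0_norm // {1}(divz_eq z (p ^ k)%N%:Z).
by rewrite intrD addrK intrM mulfK //; exact: pk_neq0.
Qed.

End QZfracTheory.

(** * The splitting *)

(** x k ^+ i |-> i / p ^ k is well defined because both x k ^+ i and the class
of i / p ^ k are determined by, and determine, i modulo p ^ k, compatibly with
passing from k to a larger index. *)
Lemma prufer_span_to_quasicyclic (G : groupType) p (x : nat -> G) :
  prime p -> prufer_sequence p x ->
  exists phi : G -> QZ, forall k i, phi (x k ^+ i) = QZfrac p k i.
Proof.
move=> pr_p xP.
have [phi phiP] : {phi : G -> QZ & forall y, prufer_span x y ->
    exists k i, y = x k ^+ i /\ phi y = QZfrac p k i}.
  apply: (@choice _ _ (fun y u => prufer_span x y ->
    exists k i, y = x k ^+ i /\ u = QZfrac p k i)) => y.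
  have [[k [i yE]]|] := pselect (prufer_span x y); last by exists 0%R.
  by exists (QZfrac p k i) => _; exists k, i.
exists phi => k i; have [|l [j [xE ->]]] := phiP (x k ^+ i).
  by exists k, i.
rewrite -(QZfrac_shift pr_p l k) -(QZfrac_shift pr_p k l) addnC.
apply/QZfrac_eqmod => //; apply/(prufer_seq_eqmod pr_p xP).
by rewrite !expgnA (prufer_seq_shift xP) addnC (prufer_seq_shift xP).
Qed.

Lemma isomorphic_of_morph (G K : groupType) (f : G -> K) :
  {morph f : a b / a * b} -> injective f -> (forall y, exists x, f x = y) ->
  isomorphic G K.
Proof.
move=> fM finj fsurj.
pose F : {multiplicative G -> K} := HB.pack f (isMultiplicative.Build G K f fM).
have [g fg] := choice fsurj.
by exists F, g => // a; apply: finj; rewrite fg.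
Qed.

Lemma primary_coprimeK p m (u : QmodZ) : prime p -> ~~ (p %| m)%N ->
  primary p u -> exists l, u = (u ^+ m) ^+ l.
Proof.
move=> pr_p pm /asboolP[j uj]; apply: expg_coprimeK uj _.
by rewrite coprime_sym coprimeXl // prime_coprime.
Qed.

(** With H = G / P of order m prime to p and v the transfer to the p-primary
part of Q/Z, the map is g |-> (v g, g P). It is injective because v is the m-th
power map on P up to the identification phi, and surjective because that power
map is onto: correct a representative of a coset by an element of P. *)
Lemma prufer_split (G : groupType) (n p : nat) (x : nat -> G) :
  is_independence_number (@power_graph G) n -> prime p -> prufer_sequence p x ->
  exists H : finGroupType,
    ~~ (p %| #|H|)%N /\ isomorphic G (quasicyclic p * H)%type.
Proof.
move=> alphaG pr_p xP.
have central a g := @prufer_span_central _ _ _ pr_p xP _ alphaG a g.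
have NJ a b : prufer_span x a -> prufer_span x (a ^ b).
  by move=> Pa; rewrite conjgE (central _ b Pa) mulKg.
have [H [f [r [fM rK fE]]]] := finite_quotient (prufer_span1 x)
  (@prufer_spanM _ _ _ xP) (@prufer_spanV _ _ _ pr_p xP) NJ
  (pfree_finite pr_p xP alphaG) (prufer_span_coset pr_p xP alphaG).
exists H.
have f1 : f 1 = 1 by apply/fE/prufer_span1.
have fX a k : f (a ^+ k) = f a ^+ k.
  by elim: k => [//|k IH]; rewrite !expgS fM IH.
have fV a : f a^-1 = (f a)^-1 by apply/esym/mulg1_eq; rewrite -fM mulgV.
have pH : ~~ (p %| #|H|)%N.
  apply/negP; rewrite -cardsT => /(Cauchy pr_p)[t _ ot].
  have [h ph] := prufer_span_coset pr_p xP alphaG (r t).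
  move=> /fE; rewrite fM fV rK => /divg1_eq th.
  case/negP: ph; rewrite -ot order_dvdn th -fX.
  by rewrite expg_elt_order f1.
split=> //.
have [phi phiE] := prufer_span_to_quasicyclic pr_p xP.
have phiM a b : f a = 1 -> f b = 1 -> phi (a * b) = (phi a + phi b)%R.
  move=> /fE[k [i ->]] /fE[l [j ->]].
  have -> : x k ^+ i = x (k + l)%N ^+ (p ^ l * i)%N.
    by rewrite expgnA (prufer_seq_shift xP).
  have -> : x l ^+ j = x (k + l)%N ^+ (p ^ k * j)%N.
    by rewrite expgnA addnC (prufer_seq_shift xP).
  by rewrite -expgnDr !phiE QZfracD.
have phi_inj a : f a = 1 -> phi a = 0%R -> a = 1.
  move=> /fE[k [i ->]]; rewrite phiE -(QZfrac0 p k) => /(QZfrac_eqmod pr_p) i0.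
  exact/(prufer_seq_eqmod pr_p xP k i 0).
have [c [fc vM vE]] :=
  transfer fM rK (fun a b fa => central a b ((fE a).1 fa)) phiM.
pose v g := (\sum_t phi (c g t))%R.
have {}vM g h : v (g * h) = (v g + v h)%R by exact: vM.
have {}vE a : f a = 1 -> v a = (phi a *+ #|H|)%R by exact: vE.
have prim_v g : primary (G := QmodZ) p (v g).
  apply: (big_ind (fun u : QmodZ => primary p u)) => [|u w pu pw|t _].
  - exact: (primary_group_closed p).1.
  - exact: (group_closedM (primary_group_closed p)).
  - have /fE[k [i ->]] := fc g t.
    by apply/(primaryP pr_p); exists k, i.
pose F g : (quasicyclic p * H)%type := (exist _ (v g) (prim_v g), f g).
apply: (@isomorphic_of_morph _ _ F) => [a b|a b|[[u pu] t]].
- by congr pair; [apply/val_inj/vM | apply: fM].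
- move=> /[dup] /(congr1 (fun y => val y.1)) /= vab /(congr1 snd) /= fab.
  have fab1 : f (a * b^-1) = 1 by rewrite fM fV fab mulgV.
  have : v (a * b^-1) = 0%R.
    apply: (GRing.addIr (v b)); rewrite -vM mulgVK GRing.add0r; exact: vab.
  rewrite vE // => phi0; apply/divg1_eq/phi_inj => //.
  have /fE[k [i abE]] := fab1.
  have [|l ->] := @primary_coprimeK p _ (phi (a * b^-1)) pr_p pH.
    by apply/(primaryP pr_p); exists k, i; rewrite abE.
  by rewrite [X in X ^+ l]QmodZ_expg phi0 expg1n.
- have [w wE] : exists w : QmodZ, primary p w /\
      w ^+ #|H| = ((u : QZ) - v (r t))%R.
    set z : QmodZ := ((u : QZ) - v (r t))%R.
    have pz : primary p z.
      exact: (primary_group_closed p).2 u (v (r t)) pu (prim_v (r t)).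
    have [l zE] := primary_coprimeK pr_p pH pz.
    exists (z ^+ l); split; last by rewrite expgnAC -zE.
    have [j zj] := asboolP _ pz.
    by apply/asboolP; exists j; rewrite expgnAC zj expg1n.
  have [/(primaryP pr_p)[k [i wki]] wm] := wE.
  have fx : f (x k ^+ i) = 1 by apply/fE; exists k, i.
  exists (x k ^+ i * r t); congr pair; last by rewrite fM fx mul1g rK.
  apply: val_inj => /=; rewrite vM vE // phiE -wki.
  by rewrite -QmodZ_expg wm GRing.subrK.
Qed.

Theorem theorem3 (G : groupType) :
  finite_independence_number (@power_graph G) ->
  finite_set [set: G] \/
  exists (p : nat) (H : finGroupType),
    [/\ prime p, ~~ (p %| #|H|)%N &
        isomorphic G (quasicyclic p * H)%type].
Proof.
move=> [n alphaG]; have [|infG] := pselect (finite_set [set: G]); first by left.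
right; have [p pr_p px] := pprimary_unbounded alphaG infG.
have [x xP] := prufer_sequence_exists alphaG pr_p px.
have [H [pH isoG]] := prufer_split alphaG pr_p xP.
by exists p, H.
Qed.
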